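(* There is an absolute constant $C>0$ such that for every $n\ge 2$ and every Boolean function $f:\{0,1\}^n\times\{0,1\}^n\to\{0,1\}$, $$Q^{\parallel}(f)\le C\cdot 2^{2\,R^{1,pub}(f)}\log n .$$
   Context: All protocols compute $f$ with error probability at most $1/3$ on every input. $Q^{\parallel}(f)$ is the minimal total number of qubits communicated in a quantum simultaneous-message-passing (SMP) protocol for $f$ with no shared randomness and no shared entanglement: Alice (holding $x$) and Bob (holding $y$) each send one quantum message to a referee who holds no input and outputs the answer. $R^{1,pub}(f)$ is the minimal number of bits of a classical one-way protocol (Alice sends a single message to Bob, who outputs the answer) where Alice and Bob share an unlimited amount of public randomness not counted in the cost. *)

(* Defs.v *)
From HB Require Import structures.
From mathcomp Require Import all_boot all_order all_algebra.
From mathcomp Require Import reals Rstruct Rstruct_topology complex mxtens exp.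
Set Implicit Arguments. Unset Strict Implicit. Unset Printing Implicit Defensive.
Import Order.TTheory GRing.Theory Num.Theory.
Local Open Scope ring_scope.

Notation Rr := Rdefinitions.R.
Notation Cplx := (Rr[i]).

Notation bits n := (n.-tuple bool).

Definition oneway_pub_protocol (n c : nat) (f : bits n -> bits n -> bool) : Prop :=
  exists (Omega : finType) (p : Omega -> Rr)
         (alice : Omega -> bits n -> bits c)
         (bob : Omega -> bits c -> bits n -> bool),
    (forall w, 0 <= p w) /\ (\sum_w p w = 1) /\
    forall x y,
      2 / 3 <= \sum_w p w * ((bob w (alice w x) y == f x y)%:R : Rr).

Definition R1pub_is (n : nat) (f : bits n -> bits n -> bool) (r : nat) : Prop :=
  oneway_pub_protocol r f /\ forall c, oneway_pub_protocol c f -> (r <= c)%N.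

Definition adjmx (m k : nat) (A : 'M[Cplx]_(m, k)) : 'M[Cplx]_(k, m) :=
  (map_mx Num.conj A)^T.

(* positive semidefinite: v^* A v >= 0 for every complex vector v
   (in the numClosedField order, 0 <= z means z is real and nonnegative) *)
Definition psdmx (d : nat) (A : 'M[Cplx]_d) : Prop :=
  forall v : 'cV[Cplx]_d, 0 <= (adjmx v *m A *m v) 0 0.

Definition density (d : nat) (rho : 'M[Cplx]_d) : Prop :=
  psdmx rho /\ \tr rho = 1.

(* A quantum SMP protocol (no shared randomness, no shared entanglement):
   Alice sends a qA-qubit state rho_x, Bob sends a qB-qubit state sigma_y,
   the referee performs a two-outcome measurement (POVM {M, 1 - M}) on the
   joint state rho_x (x) sigma_y and outputs 1 on outcome M.
   Probability of output 1 is tr(M (rho_x (x) sigma_y)). Correctness: the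
   referee outputs f x y with probability at least 2/3 on every input. *)
Definition qsmp_protocol (n qA qB : nat) (f : bits n -> bits n -> bool) : Prop :=
  exists (rho : bits n -> 'M[Cplx]_(2 ^ qA)) (sigma : bits n -> 'M[Cplx]_(2 ^ qB))
         (M : 'M[Cplx]_(2 ^ qA * 2 ^ qB)),
    (forall x, density (rho x)) /\ (forall y, density (sigma y)) /\
    psdmx M /\ psdmx (1%:M - M) /\
    forall x y,
      let p1 := \tr (M *m tensmx (rho x) (sigma y)) in
      if f x y then 2 / 3 <= p1 else 2 / 3 <= 1 - p1.

Definition Qpar_le (n : nat) (f : bits n -> bits n -> bool) (q : Rr) : Prop :=
  exists qA qB, qsmp_protocol qA qB f /\ ((qA + qB)%:R : Rr) <= q.

Definition log2 (x : Rr) : Rr := ln x / ln 2.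

(* Main.v *)
Require Import Defs.
From HB Require Import structures.
From mathcomp Require Import all_boot all_order all_algebra.
From mathcomp Require Import reals Rstruct Rstruct_topology complex mxtens exp.
From mathcomp Require Import ring lra zify.
Set Implicit Arguments.
Unset Strict Implicit.
Unset Printing Implicit Defensive.
Import Order.TTheory GRing.Theory Num.Theory.
Local Open Scope ring_scope.

(* By Newman's argument 2^t = O(n) fixed values of the public randomness suffice,
   with error below 2/5 on every input. Alice sends the uniform superposition of
   |i>|m>|1> with m her message under the i-th value; Bob sends the uniform
   superposition of |i>|m>|b> over all i and m, with b his answer to message m.
   Their inner product is 2^(-r/2) times the fraction of accepting values i, so
   the acceptance probabilities of a swap test on 1-inputs and 0-inputs differ by
   a constant times 2^(-r), and O(4^r) independent swap tests followed by a
   threshold decide f by Chebyshev's inequality. This costs O(4^r (log n + r))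
   qubits; when 2^r > n, sending both inputs is cheaper. *)

(** * Second moments of independent samples *)

(** After the square is expanded, each cross term factors over the coordinates and contains the mean
    of [g], which is zero; only the k diagonal terms survive. *)
Lemma product_second_moment (R : comNzRingType) (k : nat) (J : finType)
    (pi g : J -> R) :
  \sum_j pi j = 1 -> \sum_j pi j * g j = 0 ->
  \sum_(z : {ffun 'I_k -> J}) (\prod_i pi (z i)) * (\sum_i g (z i)) ^+ 2 =
  k%:R * \sum_j pi j * g j ^+ 2.
Proof.
move=> pi1 g0.
(* The exponent counts how many of [l] and [m] equal [i], so one product formula covers both the
   diagonal and the cross terms. *)
pose h (i l m : 'I_k) j := pi j * g j ^+ ((i == l) + (i == m)).
have hE l m : \sum_(z : {ffun 'I_k -> J})
    (\prod_i pi (z i)) * (g (z l) * g (z m)) = \prod_i \sum_j h i l m j.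
  rewrite bigA_distr_bigA; apply: eq_bigr => z _; rewrite /h big_split /=.
  congr (_ * _).
  have single q : \prod_i g (z i) ^+ (i == q) = g (z q).
    by rewrite (bigD1 q) //= eqxx big1 ?mulr1 // => i /negPf->.
  by under [RHS]eq_bigr do rewrite exprD; rewrite big_split /= !single.
have -> : \sum_(z : {ffun 'I_k -> J}) (\prod_i pi (z i)) * (\sum_i g (z i)) ^+ 2 =
    \sum_l \sum_m \prod_i \sum_j h i l m j.
  under [RHS]eq_bigr do under eq_bigr do rewrite -hE.
  under [RHS]eq_bigr do rewrite exchange_big.
  rewrite [RHS]exchange_big; apply: eq_bigr => z _ /=.
  rewrite expr2 big_distrlr big_distrr /=; apply: eq_bigr => l _.
  by rewrite big_distrr.
have offdiag l m : m != l -> \prod_i \sum_j h i l m j = 0.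
  move=> lm; rewrite (bigD1 l) //= [X in X * _](_ : _ = 0) ?mul0r //.
  by rewrite -[RHS]g0; apply: eq_bigr => j _; rewrite /h eqxx eq_sym (negPf lm).
under eq_bigr => l _.
  rewrite (bigD1 l) //= [X in _ + X]big1 => [|m lm]; last exact: offdiag.
  rewrite addr0 (bigD1 l) //= [X in _ * X]big1 => [|i il]; last first.
    by rewrite -[RHS]pi1; apply: eq_bigr => j _; rewrite /h (negPf il) mulr1.
  rewrite mulr1; under eq_bigr do rewrite /h eqxx.
  over.
by rewrite sumr_const card_ord mulr_natl.
Qed.

(** Markov's inequality for the squared deviation, whose expectation is k times the variance of one
    sample. *)
Lemma product_chebyshev (R : realFieldType) (k : nat) (J : finType)
    (pi g : J -> R) (s t : R) (P : pred {ffun 'I_k -> J}) :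
  (forall j, 0 <= pi j) -> \sum_j pi j = 1 -> \sum_j pi j * g j = s ->
  \sum_j pi j * (g j - s) ^+ 2 <= 1 -> 0 < t ->
  (forall z, P z -> t ^+ 2 <= (\sum_i g (z i) - k%:R * s) ^+ 2) ->
  \sum_(z | P z) \prod_i pi (z i) <= k%:R / t ^+ 2.
Proof.
move=> pi0 pi1 mean var t0 dev.
have centered : \sum_j pi j * (g j - s) = 0.
  under eq_bigr do rewrite mulrBr.
  by rewrite big_split /= sumrN -mulr_suml pi1 mean mul1r subrr.
have := product_second_moment k pi1 centered.
rewrite ler_pdivlMr ?exprn_gt0 // => moment.
apply: le_trans (_ : k%:R * \sum_j pi j * (g j - s) ^+ 2 <= _); last first.
  by rewrite ler_piMr.
rewrite -moment mulr_suml big_mkcond /=; apply: ler_sum => z _.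
have prod0 : 0 <= \prod_i pi (z i) by apply: prodr_ge0.
case: ifP => [/dev devz|_]; last by rewrite mulr_ge0 ?sqr_ge0.
rewrite ler_wpM2l //; apply: le_trans devz _.
by rewrite big_split /= sumrN sumr_const card_ord mulr_natl.
Qed.

(** * Replacing public randomness by a short list of samples *)

(** Bernoulli's inequality gives a factor 2 for every 128 steps, hence 4 for every 256. This pays
    for the union bound over the 4^n input pairs. *)
Lemma bernoulli_pow4 (R : realFieldType) (n T : nat) :
  (256 * n <= T)%N -> 4 ^+ n <= (1 + 1 / 128 : R) ^+ T.
Proof.
move=> leT.
have bern m : 1 + m%:R * (1 / 128) <= (1 + 1 / 128 : R) ^+ m.
  elim: m => [|m IH]; first by rewrite mul0r addr0 expr0.
  rewrite exprS mulrSr; have : 0 <= m%:R :> R by [].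
  by nra.
apply: le_trans (_ : (1 + 1 / 128 : R) ^+ (256 * n) <= _); last first.
  by rewrite ler_weXn2l //; lra.
rewrite exprM lerXn2r ?nnegrE //; first by apply: exprn_ge0; lra.
rewrite (_ : 256 = 128 * 2)%N // exprM.
by have := bern 128%N; nra.
Qed.

(* Newman's argument. The exponential moment E[b^(5 #errors)] with b = 17/16
   grows by a factor at most 1 + (b^5 - 1)/3 per sample, whereas a tuple that
   is bad for z contributes b^(2T); the ratio of the two rates is below
   128/129. *)
Lemma newman_sampling (R : realFieldType) (Om Z : finType) (p : Om -> R)
    (err : Z -> Om -> bool) (n T : nat) :
  (forall w, 0 <= p w) -> \sum_w p w = 1 ->
  (forall z, \sum_w p w * (err z w)%:R <= 1 / 3) ->
  (#|Z| <= 4 ^ n)%N -> (0 < T)%N -> (256 * n <= T)%N ->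
  exists w : {ffun 'I_T -> Om}, forall z,
    (5 * (\sum_i err z (w i)) < 2 * T)%N.
Proof.
move=> p0 p1 perr cardZ T0 leT.
suff /existsP[w /forallP ok] : [exists w : {ffun 'I_T -> Om},
    [forall z, (5 * (\sum_i err z (w i)) < 2 * T)%N]] by exists w.
apply: contraT => /existsPn bad.
pose b : R := 17 / 16; pose rho : R := 1 + (b ^+ 5 - 1) / 3.
have b1 : 1 <= b by rewrite /b; lra.
have rho0 : 0 <= rho by rewrite /rho /b; lra.
have rate : rho * (1 + 1 / 128) < b ^+ 2 by rewrite /rho /b; lra.
have moment z : \sum_w p w * b ^+ (5 * err z w) <= rho.
  have -> : \sum_w p w * b ^+ (5 * err z w) =
      1 + (b ^+ 5 - 1) * \sum_w p w * (err z w)%:R.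
    rewrite -{1}p1 mulr_sumr -big_split; apply: eq_bigr => w _ /=.
    case: (err z w); last by rewrite muln0 expr0 !mulr1 mulr0 mulr0 addr0.
    by rewrite muln1 mulr1; ring.
  rewrite /rho lerD2l ler_wpM2l //; last by have := perr z; lra.
  by rewrite subr_ge0 exprn_ege1.
(* If every tuple is bad for some [z], the average of the constant b^(2T) is at most the sum over
   all [z] of the exponential moments, and by independence each of these is at most rho^T. *)
have upper : b ^+ (2 * T) <= 4 ^+ n * rho ^+ T.
  have -> : b ^+ (2 * T) =
      \sum_(w : {ffun 'I_T -> Om}) (\prod_i p (w i)) * b ^+ (2 * T).
    rewrite -mulr_suml -(bigA_distr_bigA (fun _ : 'I_T => p)).
    by rewrite big1 ?mul1r // => i _.
  apply: le_trans (_ : \sum_(w : {ffun 'I_T -> Om}) \sum_z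
      \prod_i (p (w i) * b ^+ (5 * err z (w i))) <= _).
    apply: ler_sum => w _; have /forallPn[z] := bad w; rewrite -leqNgt => badz.
    have ge0 z' : 0 <= \prod_i (p (w i) * b ^+ (5 * err z' (w i))).
      by apply: prodr_ge0 => i _; rewrite mulr_ge0 ?exprn_ge0 // (le_trans _ b1).
    rewrite (bigD1 z) //= ler_wpDr ?sumr_ge0 //.
    rewrite big_split /= ler_wpM2l ?prodr_ge0 //.
    rewrite prodrXr -big_distrr /=.
    by rewrite ler_weXn2l.
  rewrite exchange_big /=.
  apply: le_trans (_ : \sum_(z : Z) rho ^+ T <= _).
    apply: ler_sum => z _; rewrite -(bigA_distr_bigA (fun _ w => p w * b ^+ (5 * err z w))).
    rewrite prodr_const card_ord lerXn2r ?nnegrE //.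
    by apply: sumr_ge0 => w _; rewrite mulr_ge0 ?exprn_ge0 // (le_trans _ b1).
  rewrite sumr_const -[leLHS]mulr_natl ler_wpM2r ?exprn_ge0 //.
  by rewrite -natrX ler_nat.
have : 4 ^+ n * rho ^+ T < b ^+ (2 * T).
  rewrite exprM (le_lt_trans (y := (rho * (1 + 1 / 128)) ^+ T)) //; last first.
    by rewrite ltrXn2r ?nnegrE ?mulr_ge0 ?exprn_ge0 ?lt0n_neq0 //; lra.
  by rewrite exprMn mulrC ler_wpM2l ?exprn_ge0 ?bernoulli_pow4.
by rewrite ltNge upper.
Qed.

(** * From real vectors and real projectors to quantum protocols *)

Lemma sum_delta (R : pzRingType) (I : finType) (s : I) (F : I -> R) :
  \sum_i (i == s)%:R * F i = F s.
Proof.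
rewrite (bigD1 s) //= eqxx mul1r big1 ?addr0 // => i /negPf->.
by rewrite mul0r.
Qed.

Lemma sum_pair (R : nmodType) (I J : finType) (F : I * J -> R) :
  \sum_p F p = \sum_i \sum_j F (i, j).
Proof. by rewrite pair_bigA; apply: eq_bigr => -[]. Qed.

Lemma psdmx_gram (m d : nat) (A : 'M[Cplx]_(m, d)) : psdmx (adjmx A *m A).
Proof.
move=> v; rewrite mulmxA -mulmxA.
have -> : adjmx v *m adjmx A = adjmx (A *m v).
  by rewrite /adjmx map_mxM trmx_mul.
by rewrite !mxE; apply: sumr_ge0 => i _; rewrite !mxE mulrC mul_conjC_ge0.
Qed.

Lemma psdmx_proj (d : nat) (G : 'M[Cplx]_d) :
  adjmx G = G -> G *m G = G -> psdmx G.
Proof. by move=> Gh GG; have := psdmx_gram G; rewrite Gh GG. Qed.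

Lemma psdmx_proj_compl (d : nat) (G : 'M[Cplx]_d) :
  adjmx G = G -> G *m G = G -> psdmx (1%:M - G).
Proof.
move=> Gh GG; apply: psdmx_proj.
  by rewrite /adjmx map_mxB map_mx1 linearB /= trmx1 -[in RHS]Gh.
by rewrite mulmxBl !mulmxBr !mul1mx mulmx1 GG subrr subr0.
Qed.

Lemma conj_real_complex (x : Rr) : Num.conj (x%:C)%C = (x%:C)%C.
Proof. by apply: conj_Creal; rewrite complex_real. Qed.

(* Acceptance probability <u (x) v | K | u (x) v> of the projective measurement
   K on the product of two real pure states. *)
Definition accept_prob (A B : finType) (u : A -> Rr) (v : B -> Rr)
    (K : A * B -> A * B -> Rr) : Rr :=
  \sum_i \sum_j u i.1 * v i.2 * K i j * (u j.1 * v j.2).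

(** Lets the protocols below be described by real amplitudes over any finite types of the right
    size. A symmetric idempotent kernel is an orthogonal projector, so it and its complement form a
    valid measurement. *)
Lemma qsmp_of_real_projector (n qA qB : nat) (f : bits n -> bits n -> bool)
    (A B : finType) (u : bits n -> A -> Rr) (v : bits n -> B -> Rr)
    (K : A * B -> A * B -> Rr) :
  #|A| = (2 ^ qA)%N -> #|B| = (2 ^ qB)%N ->
  (forall x, \sum_a u x a ^+ 2 = 1) -> (forall y, \sum_b v y b ^+ 2 = 1) ->
  (forall i j, K i j = K j i) ->
  (forall i j, \sum_h K i h * K h j = K i j) ->
  (forall x y, if f x y then 2 / 3 <= accept_prob (u x) (v y) K
               else accept_prob (u x) (v y) K <= 1 / 3) ->
  qsmp_protocol qA qB f.
Proof.
move=> cA cB u1 v1 Ksym Kidem Kacc.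
pose eA (i : 'I_(2 ^ qA)) : A := enum_val (cast_ord (esym cA) i).
pose eB (i : 'I_(2 ^ qB)) : B := enum_val (cast_ord (esym cB) i).
have bij_enum (S : finType) q (cS : #|S| = q) :
    bijective (fun i : 'I_q => enum_val (cast_ord (esym cS) i) : S).
  by case: q / cS; apply: (eq_bij (enum_val_bij S)) => i; rewrite cast_ord_id.
have bA : bijective eA by apply: bij_enum.
have bB : bijective eB by apply: bij_enum.
(* Reads a row index of the Kronecker product as a pair of basis labels. *)
pose e (k : 'I_(2 ^ qA * 2 ^ qB)) : A * B :=
  (eA (mxtens_unindex k).1, eB (mxtens_unindex k).2).
have be : bijective e.
  case: bA => gA eAK gAK; case: bB => gB eBK gBK.
  exists (fun p => mxtens_index (gA p.1, gB p.2)) => [k|[a b]].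
    rewrite -[LHS]/(mxtens_index (gA (eA (mxtens_unindex k).1),
                                  gB (eB (mxtens_unindex k).2))).
    by rewrite eAK eBK -surjective_pairing mxtens_unindexK.
  by rewrite /e mxtens_indexK /= gAK gBK.
(* A rank-one state is the Gram matrix of a row vector, and its trace is the squared norm of that
   vector. *)
have pure (S : finType) q (g : 'I_q -> S) (w : S -> Rr) : bijective g ->
    \sum_a w a ^+ 2 = 1 ->
    density (\matrix_(i, j) ((w (g i) * w (g j))%:C)%C : 'M[Cplx]_q).
  move=> bg w1; split.
    rewrite (_ : (\matrix_(i, j) _) = adjmx (\row_j ((w (g j))%:C)%C) *m
                                      (\row_j ((w (g j))%:C)%C)).
      exact: psdmx_gram.
    apply/matrixP => i j; rewrite !mxE big_ord1 !mxE conj_real_complex.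
    by rewrite rmorphM.
  rewrite /mxtrace (eq_bigr (fun i => ((w (g i) ^+ 2)%:C)%C)) => [|i _]; last first.
    by rewrite mxE expr2.
  rewrite -rmorph_sum /= -[RHS](rmorph1 (real_complex Rr)) -w1.
  by rewrite (reindex g) //; apply: onW_bij.
pose M : 'M[Cplx]_(2 ^ qA * 2 ^ qB) := \matrix_(i, j) ((K (e i) (e j))%:C)%C.
have Mh : adjmx M = M.
  by apply/matrixP => i j; rewrite !mxE conj_real_complex Ksym.
have MM : M *m M = M.
  apply/matrixP => i j; rewrite !mxE.
  rewrite -Kidem (reindex e) /=; last exact: onW_bij.
  by rewrite rmorph_sum; apply: eq_bigr => h _; rewrite !mxE rmorphM.
exists (fun x => \matrix_(i, j) ((u x (eA i) * u x (eA j))%:C)%C),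
  (fun y => \matrix_(i, j) ((v y (eB i) * v y (eB j))%:C)%C), M.
split; first by move=> x; apply: pure.
split; first by move=> y; apply: pure.
split; first exact: psdmx_proj.
split; first exact: psdmx_proj_compl.
move=> x y; cbv zeta; set p1 := \tr _.
have -> : p1 = ((accept_prob (u x) (v y) K)%:C)%C.
  rewrite /p1 /mxtrace /accept_prob (reindex e) /=; last exact: onW_bij.
  rewrite rmorph_sum; apply: eq_bigr => i _.
  rewrite !mxE (reindex e) /=; last exact: onW_bij.
  rewrite rmorph_sum; apply: eq_bigr => j _.
  rewrite !mxE -!rmorphM; congr (_%:C)%C; rewrite /e /=; ring.
have -> : (2 / 3 : Cplx) = (((2 / 3 : Rr))%:C)%C.
  by rewrite rmorphM fmorphV !rmorph_nat.
move: (Kacc x y); case: (f x y) => acc.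
  by rewrite lecR.
by rewrite -(rmorph1 (real_complex Rr)) -rmorphB lecR; lra.
Qed.

(** Both inputs are sent as basis states, and the referee's projector is diagonal with the values of
    [f] as its entries. *)
Lemma trivial_qsmp (n : nat) (f : bits n -> bits n -> bool) :
  qsmp_protocol n n f.
Proof.
have cT : #|{: bits n}| = (2 ^ n)%N by rewrite card_tuple card_bool.
pose e (x : bits n) (a : bits n) : Rr := (a == x)%:R.
have e1 x : \sum_a e x a ^+ 2 = 1.
  rewrite (eq_bigr (fun a => (a == x)%:R * 1)) ?sum_delta // => a _.
  by rewrite /e mulr1 -natrX; case: (a == x).
pose K (i j : bits n * bits n) : Rr := (i == j)%:R * (f j.1 j.2)%:R.
apply: (qsmp_of_real_projector (u := e) (v := e) (K := K) cT cT e1 e1).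
- by move=> i j; rewrite /K eq_sym; case: eqP => [->//|_]; rewrite !mul0r.
- move=> i j; under eq_bigr => h _.
    rewrite [K i h]/K (eq_sym i) -mulrA; over.
  by rewrite /= sum_delta /K; case: eqP => [->|_]; case: (f _ _); rewrite ?mul0r ?mulr0 ?mul1r ?mulr1.
- move=> x y; have -> : accept_prob (e x) (e y) K = (f x y)%:R.
    have eE (i : bits n * bits n) : e x i.1 * e y i.2 = (i == (x, y))%:R.
      by rewrite /e -natrM mulnb -pair_eqE.
    rewrite /accept_prob.
    under eq_bigr do under eq_bigr do rewrite !eE -mulrA.
    under eq_bigr do rewrite -big_distrr /=.
    rewrite sum_delta; under eq_bigr do rewrite mulrC.
    by rewrite sum_delta /K eqxx mul1r.
  by case: (f x y); rewrite /= ?mulr1n ?mulr0n; lra.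
Qed.

(** * Swap tests and their parallel repetition *)

(* z = false projects onto the symmetric, z = true onto the antisymmetric
   subspace. *)
Definition swap_kernel (A : finType) (z : bool) (i j : A * A) : Rr :=
  ((i == j)%:R + (-1) ^+ z * (i == (j.2, j.1))%:R) / 2.

Lemma eq_swap (A : eqType) (i j : A * A) :
  (i == (j.2, j.1)) = (j == (i.2, i.1)).
Proof.
case: i j => [i1 i2] [j1 j2]; rewrite -!pair_eqE /= !(eq_sym i1) !(eq_sym i2).
by rewrite andbC.
Qed.

Lemma swap_kernel_sym (A : finType) z (i j : A * A) :
  swap_kernel z i j = swap_kernel z j i.
Proof. by rewrite /swap_kernel eq_sym eq_swap. Qed.

Lemma swap_kernel_sum (A : finType) z (i : A * A) (F : A * A -> Rr) :
  \sum_j swap_kernel z i j * F j = (F i + (-1) ^+ z * F (i.2, i.1)) / 2.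
Proof.
rewrite (eq_bigr (fun j => (j == i)%:R * (F j / 2) +
    (j == (i.2, i.1))%:R * ((-1) ^+ z * F j / 2))) => [|j _].
  by rewrite big_split /= !sum_delta; ring.
by rewrite /swap_kernel eq_sym eq_swap; ring.
Qed.

(** The two kernels are (1 + S)/2 and (1 - S)/2 for the swap S, an involution: each is idempotent
    and they are mutually orthogonal. *)
Lemma swap_kernel_mul (A : finType) z z' (i j : A * A) :
  \sum_h swap_kernel z i h * swap_kernel z' h j =
  (z == z')%:R * swap_kernel z i j.
Proof.
rewrite swap_kernel_sum.
(* The swap acts on the range of each projector as its sign. *)
have -> : swap_kernel z' (i.2, i.1) j = (-1) ^+ z' * swap_kernel z' i j.
  rewrite /swap_kernel (eq_sym (i.2, i.1) j) -eq_swap.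
  have -> : ((i.2, i.1) == (j.2, j.1)) = (i == j).
    by rewrite -!pair_eqE /= andbC.
  by case: z'; field.
by case: z z' => [] []; rewrite ?expr0 ?expr1 /=; field.
Qed.

(** The identity part contributes the product of the squared norms, the swap part the squared inner
    product. *)
Lemma swap_kernel_accept (A : finType) z (u v : A -> Rr) :
  \sum_a u a ^+ 2 = 1 -> \sum_a v a ^+ 2 = 1 ->
  accept_prob u v (swap_kernel z) =
  (1 + (-1) ^+ z * (\sum_a u a * v a) ^+ 2) / 2.
Proof.
move=> u1 v1; rewrite /accept_prob.
under eq_bigr => i _.
  under eq_bigr do rewrite -mulrA.
  rewrite -mulr_sumr swap_kernel_sum /=; over.
rewrite (eq_bigr (fun i => u i.1 ^+ 2 * v i.2 ^+ 2 / 2 +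
   (u i.1 * v i.1) * (u i.2 * v i.2) * ((-1) ^+ z / 2))) => [|i _]; last by ring.
rewrite big_split /= -!mulr_suml.
rewrite -(pair_bigA _ (fun a b => u a ^+ 2 * v b ^+ 2)) /=.
rewrite -(pair_bigA _ (fun a b => (u a * v a) * (u b * v b))) /=.
by rewrite -!big_distrlr /= u1 v1; ring.
Qed.

Lemma sum_prod_pair_ffun (A : finType) k (F : 'I_k -> A * A -> Rr) :
  \sum_(h : {ffun 'I_k -> A} * {ffun 'I_k -> A}) \prod_l F l (h.1 l, h.2 l) =
  \prod_l \sum_p F l p.
Proof.
under [RHS]eq_bigr do rewrite sum_pair.
rewrite bigA_distr_bigA /=.
rewrite -(pair_bigA _ (fun h1 h2 : {ffun 'I_k -> A} =>
   \prod_l F l (h1 l, h2 l))) /=.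
by apply: eq_bigr => h _; rewrite bigA_distr_bigA.
Qed.

(** The k tests and the decision [G] on their outcomes form a single measurement. Test [l] pairs the
    [l]-th register of Alice's message with the [l]-th of Bob's. *)
Definition swap_tests (A : finType) k (G : pred {ffun 'I_k -> bool})
    (i j : {ffun 'I_k -> A} * {ffun 'I_k -> A}) : Rr :=
  \sum_(z | G z) \prod_l swap_kernel (z l) (i.1 l, i.2 l) (j.1 l, j.2 l).

Lemma swap_tests_sym (A : finType) k G i j :
  @swap_tests A k G i j = swap_tests G j i.
Proof.
by apply: eq_bigr => z _; apply: eq_bigr => l _; apply: swap_kernel_sym.
Qed.

(** Distinct outcome patterns differ at some test, where the two projectors are orthogonal, so the
    product projectors of distinct patterns annihilate each other. *)
Lemma swap_tests_idem (A : finType) k G i j :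
  \sum_h @swap_tests A k G i h * swap_tests G h j = swap_tests G i j.
Proof.
have mul (z z' : {ffun 'I_k -> bool}) : \sum_(h : {ffun 'I_k -> A} * {ffun 'I_k -> A})
    (\prod_l swap_kernel (z l) (i.1 l, i.2 l) (h.1 l, h.2 l)) *
    (\prod_l swap_kernel (z' l) (h.1 l, h.2 l) (j.1 l, j.2 l)) =
    \prod_l ((z l == z' l)%:R * swap_kernel (z l) (i.1 l, i.2 l) (j.1 l, j.2 l)).
  under [RHS]eq_bigr do rewrite -swap_kernel_mul.
  rewrite -(sum_prod_pair_ffun (fun l h => swap_kernel (z l) (i.1 l, i.2 l) h *
     swap_kernel (z' l) h (j.1 l, j.2 l))) /=.
  by apply: eq_bigr => h _; rewrite [RHS]big_split.
rewrite /swap_tests.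
under eq_bigr do rewrite big_distrlr /=.
rewrite exchange_big /=; apply: eq_bigr => z Gz.
rewrite exchange_big /= (bigD1 z) //= mul [X in _ + X]big1 => [|z' /andP[_ zz']].
  by rewrite addr0; apply: eq_bigr => l _; rewrite eqxx mul1r.
rewrite mul; have /existsP[l zl] : [exists l, z l != z' l].
  rewrite -negb_forall; apply: contra zz' => /forallP eqz.
  by apply/eqP/ffunP => l; rewrite (eqP (eqz l)).
by rewrite (bigD1 l) //= (negPf zl) !mul0r.
Qed.

Definition tensor_power (A : finType) k (u : A -> Rr) (a : {ffun 'I_k -> A}) :
  Rr := \prod_l u (a l).

Lemma tensor_power_unit (A : finType) k (u : A -> Rr) :
  \sum_a u a ^+ 2 = 1 -> \sum_a tensor_power (k := k) u a ^+ 2 = 1.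
Proof.
move=> u1; under eq_bigr do rewrite /tensor_power -prodrXl.
by rewrite -(bigA_distr_bigA (fun _ a => u a ^+ 2)) big1.
Qed.

(** On tensor powers the amplitude sums factor over the registers, so the test outcomes are
    independent. *)
Lemma swap_tests_accept (A : finType) k (u v : A -> Rr) G :
  \sum_a u a ^+ 2 = 1 -> \sum_a v a ^+ 2 = 1 ->
  accept_prob (tensor_power (k := k) u) (tensor_power v) (swap_tests G) =
  \sum_(z | G z) \prod_l ((1 + (-1) ^+ z l * (\sum_a u a * v a) ^+ 2) / 2).
Proof.
move=> u1 v1; rewrite /accept_prob /swap_tests.
under eq_bigr => i _.
  under eq_bigr do rewrite mulr_sumr mulr_suml.
  rewrite exchange_big /=; over.
rewrite exchange_big /=; apply: eq_bigr => z _.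
under [RHS]eq_bigr do rewrite -swap_kernel_accept // /accept_prob.
rewrite -(sum_prod_pair_ffun (fun l i => \sum_j u i.1 * v i.2 *
  swap_kernel (z l) i j * (u j.1 * v j.2))) /=.
apply: eq_bigr => i _.
rewrite -(sum_prod_pair_ffun (fun l j => u (i.1 l) * v (i.2 l) *
  swap_kernel (z l) (i.1 l, i.2 l) j * (u j.1 * v j.2))) /=.
by apply: eq_bigr => j _; rewrite /tensor_power -!big_split.
Qed.

(** Each outcome, read as a sign, has mean [s] and variance 1 - s^2. Chebyshev's inequality with
    deviation k d gives error at most 1 / (k d^2), hence at most 1/3. *)
Lemma swap_tests_threshold (A : finType) k (u v : A -> Rr) (th d : Rr) :
  \sum_a u a ^+ 2 = 1 -> \sum_a v a ^+ 2 = 1 ->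
  0 < d -> 3 <= k%:R * d ^+ 2 ->
  let p := accept_prob (tensor_power (k := k) u) (tensor_power v)
    (swap_tests (fun z : {ffun 'I_k -> bool} => k%:R * th <= \sum_l (-1) ^+ z l)) in
  let s := (\sum_a u a * v a) ^+ 2 in
  s <= 1 ->
  (th + d <= s -> 2 / 3 <= p) /\ (s <= th - d -> p <= 1 / 3).
Proof.
move=> u1 v1 d0 kd p s s1.
have k0 : 0 < k%:R :> Rr.
  by rewrite lt0r ler0n andbT; apply: contraTneq kd => ->; rewrite mul0r; lra.
have s0 : 0 <= s by apply: sqr_ge0.
pose pi (z : bool) : Rr := (1 + (-1) ^+ z * s) / 2.
pose g (z : bool) : Rr := (-1) ^+ z.
have sumb (F : bool -> Rr) : \sum_z F z = F true + F false.
  by rewrite big_bool.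
have pi0 z : 0 <= pi z by rewrite /pi; case: z; rewrite ?expr0 ?expr1; lra.
have pi1 : \sum_z pi z = 1 by rewrite sumb /pi expr0 expr1; field.
have mean : \sum_z pi z * g z = s by rewrite sumb /pi /g expr0 expr1; field.
have var : \sum_z pi z * (g z - s) ^+ 2 <= 1.
  by rewrite sumb /pi /g expr0 expr1; nra.
have cheb (P : pred {ffun 'I_k -> bool}) :
    (forall z, P z -> (k%:R * d) ^+ 2 <= (\sum_i g (z i) - k%:R * s) ^+ 2) ->
    \sum_(z | P z) \prod_i pi (z i) <= 1 / 3.
  move=> dev; apply: le_trans (product_chebyshev pi0 pi1 mean var _ dev) _.
    exact: mulr_gt0.
  rewrite ler_pdivrMr ?exprn_gt0 ?mulr_gt0 // exprMn.
  by have := ler_wpM2l (ltW k0) kd; nra.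
have pE : p = \sum_(z : {ffun 'I_k -> bool} | k%:R * th <= \sum_l g (z l)) \prod_l pi (z l).
  exact: swap_tests_accept.
split=> gap; rewrite pE; last first.
  apply: cheb => z acc.
  have := ler_wpM2l (ltW k0) gap; rewrite mulrBr => gap'.
  have kd0 : 0 < k%:R * d by exact: mulr_gt0.
  rewrite lerXn2r ?nnegrE //; lra.
have total : \sum_(z : {ffun 'I_k -> bool}) \prod_l pi (z l) = 1.
  by rewrite -(bigA_distr_bigA (fun _ => pi)) big1.
move: total; rewrite (bigID (fun z : {ffun 'I_k -> bool} =>
  k%:R * th <= \sum_l g (z l))) /=.
have : \sum_(z : {ffun 'I_k -> bool} | ~~ (k%:R * th <= \sum_l g (z l))) \prod_i pi (z i) <= 1 / 3.
  apply: cheb => z; rewrite -ltNge => rej.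
  have := ler_wpM2l (ltW k0) gap; rewrite mulrDr => gap'.
  have kd0 : 0 < k%:R * d by exact: mulr_gt0.
  rewrite -[leRHS]sqrrN lerXn2r ?nnegrE //; lra.
lra.
Qed.

(** * The quantum protocol built from the sampled one-way protocol *)

(** Each party sends 300 * 4^c copies of a state on t + c + 1 qubits: the sample index, the message
    and the answer bit. *)
Lemma qsmp_of_sampled_oneway (n c t : nat) (f : bits n -> bits n -> bool)
    (al : 'I_(2 ^ t) -> bits n -> bits c)
    (bo : 'I_(2 ^ t) -> bits c -> bits n -> bool) :
  (forall x y,
     (5 * (\sum_i (bo i (al i x) y != f x y)) < 2 * 2 ^ t)%N) ->
  let q := (300 * 4 ^ c * (t + c + 1))%N in qsmp_protocol q q f.
Proof.
move=> good q.
pose T : Rr := 2 ^+ t; pose D : Rr := (2 ^+ c)^-1.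
have T0 : 0 < T by rewrite exprn_gt0.
have c0 : 0 < 2 ^+ c :> Rr by rewrite exprn_gt0.
have D0 : 0 < D by rewrite invr_gt0.
have D1 : D <= 1 by rewrite invf_le1 // exprn_ege1 ?ler1n.
have cardT : \sum_(i < 2 ^ t) (1 : Rr) = T.
  by rewrite sumr_const card_ord natrX.
pose A : finType := ('I_(2 ^ t) * (bits c * bool))%type.
pose u x (a : A) : Rr :=
  ((a.2.1 == al a.1 x) && a.2.2)%:R / Num.sqrt T.
pose v y (a : A) : Rr :=
  (a.2.2 == bo a.1 a.2.1 y)%:R / Num.sqrt (T * 2 ^+ c).
have sumA (F : A -> Rr) :
    \sum_a F a = \sum_i \sum_m (F (i, (m, true)) + F (i, (m, false))).
  rewrite sum_pair; apply: eq_bigr => i _.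
  by rewrite sum_pair; apply: eq_bigr => m _; rewrite big_bool.
have u1 x : \sum_a u x a ^+ 2 = 1.
  rewrite sumA -[RHS](mulfV (lt0r_neq0 T0)) -{1}cardT mulr_suml.
  apply: eq_bigr => i _; rewrite mul1r -(sum_delta (al i x) (fun _ => T^-1)).
  apply: eq_bigr => m _; rewrite /u /= andbT andbF !exprMn exprVn sqr_sqrtr ?ltW //.
  by rewrite -!natrX mul0r addr0; case: (m == _).
have v1 y : \sum_a v y a ^+ 2 = 1.
  have Tc0 : 0 < T * 2 ^+ c by rewrite mulr_gt0.
  rewrite sumA -[RHS](mulfV (lt0r_neq0 Tc0)) -{1}cardT mulr_suml mulr_suml.
  apply: eq_bigr => i _; rewrite mul1r.
  have -> : 2 ^+ c = \sum_(m : bits c) (1 : Rr).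
    by rewrite sumr_const card_tuple card_bool natrX.
  rewrite mulr_suml; apply: eq_bigr => m _.
  rewrite /v /= !exprMn exprVn sqr_sqrtr ?ltW // -mulrDl -!natrX -natrD.
  by rewrite sumr_const card_tuple card_bool natrX; case: (bo _ _ _).
pose N x y : nat := (\sum_i bo i (al i x) y)%N.
(* The supports meet exactly in the labels (i, [al i x], [true]) for which Bob answers 1. *)
have inner x y : (\sum_a u x a * v y a) ^+ 2 = ((N x y)%:R / T) ^+ 2 * D.
  have -> : \sum_a u x a * v y a =
      (N x y)%:R / (Num.sqrt T * Num.sqrt (T * 2 ^+ c)).
    rewrite sumA /N natr_sum mulr_suml; apply: eq_bigr => i _.
    rewrite -(sum_delta (al i x) (fun m => (bo i m y)%:R / _)).
    apply: eq_bigr => m _; rewrite /u /v /= andbT andbF mul0r mul0r addr0 invfM.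
    by case: (bo _ _ _); rewrite /= ?mulr1n ?mulr0n; ring.
  rewrite !exprMn exprVn exprMn !sqr_sqrtr ?mulr_ge0 ?ltW // /D.
  by field; rewrite !lt0r_neq0.
set k := (300 * 4 ^ c)%N in q *.
have cardA : #|{ffun 'I_k -> A}| = (2 ^ q)%N.
  rewrite card_ffun card_ord !card_prod card_ord card_tuple card_bool.
  by rewrite -[X in (_ * (_ * X))%N]expn1 -!expnD -expnM mulnC addnA.
(* The squared overlap is at least (3/5)^2 D on 1-inputs and at most (2/5)^2 D on 0-inputs. The
   threshold 13/50 D is the midpoint, at distance D/10 from both. *)
apply: (qsmp_of_real_projector cardA cardA (u := fun x => tensor_power (u x))
  (v := fun y => tensor_power (v y))
  (K := swap_tests (fun z : {ffun 'I_k -> bool} =>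
     k%:R * (13 / 50 * D) <= \sum_l (-1) ^+ z l))).
- by move=> x; apply: tensor_power_unit.
- by move=> y; apply: tensor_power_unit.
- exact: swap_tests_sym.
- exact: swap_tests_idem.
move=> x y.
(* The factor 300 in [k] is chosen to make this an equality. *)
have kD : 3 <= k%:R * (D / 10) ^+ 2.
  have -> : k%:R = 300 * (2 ^+ c) ^+ 2 :> Rr.
    by rewrite /k natrM natrX -exprM mulnC exprM; congr (_ * _ ^+ _); ring.
  rewrite /D le_eqVlt; apply/orP; left; apply/eqP.
  by field; rewrite lt0r_neq0.
have d0 : 0 < D / 10 by rewrite divr_gt0.
have NT : (N x y + \sum_i ~~ bo i (al i x) y = 2 ^ t)%N.
  rewrite -big_split /= -[RHS]card_ord -sum1_card; apply: eq_bigr => i _.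
  by case: (bo _ _ _).
have nu0 : 0 <= (N x y)%:R / T by rewrite divr_ge0 ?(ltW T0).
have nu1 : (N x y)%:R / T <= 1.
  by rewrite ler_pdivrMr // mul1r /T -natrX ler_nat -NT leq_addr.
have s1 : (\sum_a u x a * v y a) ^+ 2 <= 1 by rewrite inner mulr_ile1 ?sqr_ge0 ?exprn_ile1 ?(ltW D0).
have [hi lo] := swap_tests_threshold (13 / 50 * D) (u1 x) (v1 y) d0 kD s1.
have := good x y; case fxy: (f x y) => gxy.
  apply: hi; rewrite inner.
  have : 3 / 5 <= (N x y)%:R / T.
    rewrite ler_pdivlMr // mulrAC ler_pdivrMr // /T -natrX -!natrM ler_nat.
    move: gxy NT; under eq_bigr do rewrite eqb_id.
    by move: (2 ^ t)%N (N x y) (\sum_i _)%N; clear; lia.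
  have -> : 13 / 50 * D + D / 10 = (3 / 5) ^+ 2 * D by field.
  by move=> nu; rewrite ler_wpM2r ?(ltW D0) // lerXn2r ?nnegrE // divr_ge0.
apply: lo; rewrite inner.
have : (N x y)%:R / T <= 2 / 5.
  rewrite ler_pdivrMr // mulrAC ler_pdivlMr // /T -natrX -!natrM ler_nat.
  move: gxy; under eq_bigr do rewrite eqbF_neg negbK.
  by rewrite -/(N x y); move: (2 ^ t)%N (N x y); clear; lia.
have -> : 13 / 50 * D - D / 10 = (2 / 5) ^+ 2 * D by field.
by move=> nu; rewrite ler_wpM2r ?(ltW D0) // lerXn2r ?nnegrE // divr_ge0.
Qed.

(** * Counting qubits *)

Lemma natr_le_log2 (m K : nat) : (2 ^ m <= K)%N -> m%:R <= log2 K%:R.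
Proof.
move=> mK; have l2 : 0 < ln 2 :> Rr by rewrite ln_gt0 ?ltr1n.
rewrite /log2 ler_pdivlMr // mulr_natl -lnXn // -natrX.
rewrite ler_ln ?posrE ?ltr0n ?expn_gt0 ?ler_nat //.
by apply: leq_trans mK; rewrite expn_gt0.
Qed.

Theorem mainTheorem2 :
  exists C : Rr, 0 < C /\
    forall (n : nat), (2 <= n)%N ->
    forall (f : bits n -> bits n -> bool) (r : nat),
      R1pub_is f r ->
      Qpar_le f (C * 2 ^+ (2 * r) * log2 n%:R).
Proof.
(* The constant is 7200 = 2 * 300 * 12: two messages of 300 * 4^r * (t + r + 1) qubits, where t + r
   + 1 is at most 12 log n. *)
exists (90 * 80); split; first by rewrite mulr_gt0.
move=> n n2 f r [[Om [p [alice [bob [p0 [p1 succ]]]]]] _].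
have log1 : 1 <= log2 n%:R := natr_le_log2 (m := 1) n2.
rewrite (_ : 2 ^+ (2 * r) = (4 ^ r)%:R); last by rewrite exprM natrX -natrX.
have [rn|nr] := leqP (2 ^ r) n; last first.
  exists n, n; split; first exact: trivial_qsmp.
  (* Here 2n is at most n^2 since n is at least 2, and n < 2^r. *)
  have n4 : (n + n <= 4 ^ r)%N.
    rewrite (_ : 4 = 2 * 2)%N // expnMn.
    by move: (2 ^ r)%N n2 nr; clear; nia.
  have r1 : (n + n)%:R <= (4 ^ r)%:R :> Rr by rewrite ler_nat.
  apply: le_trans r1 _; have r0 : 0 <= (4 ^ r)%:R :> Rr by [].
  have C1 : 1 <= 90 * 80 :> Rr by lra.
  by rewrite -[leLHS]mulr1 ler_pM // ler_peMl.
(* The least [t] for which 2^t samples suffice in [newman_sampling]. Minimality gives t at most 9 +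
   log n: 8 from the factor 256 and 1 from rounding up. *)
pose t := up_log 2 (256 * n).
have leT : (256 * n <= 2 ^ t)%N by apply: up_logP.
have tn : t%:R <= 9 + log2 n%:R.
  have t0 : (0 < t)%N by rewrite up_log_gt0; lia.
  have t9 : (9 <= t)%N.
    by rewrite -(@leq_exp2l 2) // (leq_trans _ leT) //; lia.
  have : (2 ^ (t - 9) <= n)%N.
    have : (2 ^ t.-1 < 256 * n)%N by apply: up_log_gtn => //; lia.
    have -> : (t.-1 = t - 9 + 8)%N by lia.
    by rewrite expnD; lia.
  move=> /natr_le_log2; rewrite natrB //; lra.
have rlog := natr_le_log2 rn.
have cardZ : (#|{: bits n * bits n}| <= 4 ^ n)%N.
  by rewrite card_prod card_tuple card_bool -expnMn.
have perr (z : bits n * bits n) :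
    \sum_w p w * (bob w (alice w z.1) z.2 != f z.1 z.2)%:R <= 1 / 3.
  suff -> : \sum_w p w * (bob w (alice w z.1) z.2 != f z.1 z.2)%:R =
      1 - \sum_w p w * (bob w (alice w z.1) z.2 == f z.1 z.2)%:R.
    by have := succ z.1 z.2; lra.
  rewrite -[X in X - _]p1 -sumrB; apply: eq_bigr => w _.
  by case: (_ == f _ _); rewrite /= ?mulr1 ?mulr0 ?subrr ?subr0.
have T0 : (0 < 2 ^ t)%N by rewrite expn_gt0.
have [w good] := newman_sampling p0 p1 perr cardZ T0 leT.
pose q := (300 * 4 ^ r * (t + r + 1))%N.
exists q, q; split.
  apply: (qsmp_of_sampled_oneway (al := fun i => alice (w i))
    (bo := fun i => bob (w i))) => x y.
  exact: good (x, y).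
rewrite natrD /q !natrM !natrD.
have r0 : 0 <= (4 ^ r)%:R :> Rr by [].
have : t%:R + r%:R + 1 <= 12 * log2 n%:R by lra.
move=> /(ler_wpM2l (mulr_ge0 (ler0n Rr 600) r0)); lra.
Qed.
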